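(* Let $\lambda$ be a totally real algebraic integer with $\lambda^2\notin\mathbb{Z}$. Then there exists a positive integer $D$ such that $D\lambda\in\mathcal{A}_2$.
   Context: An algebraic integer is totally real if all roots of its minimal polynomial over $\mathbb{Q}$ are real. The eigenvalues of a graph are those of its adjacency matrix; a rooted tree has height $h$ if the maximum distance from the root to a vertex is $h$. The arboreal height of a totally real algebraic integer $\lambda$ is the least $h$ such that some rooted tree of height $h$ has $\lambda$ as an eigenvalue; $\mathcal{A}_h$ is the set of totally real algebraic integers of arboreal height exactly $h$. *)

(* Defs.v *)
From mathcomp Require Import all_boot all_order all_algebra all_field.

Set Implicit Arguments.
Unset Strict Implicit.
Unset Printing Implicit Defensive.

Import Order.TTheory GRing.Theory Num.Theory.

Local Open Scope ring_scope.

(* A ucycle may have size 2 (an edge traversed back and forth), so the cycles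
   of a simple graph are the ucycles of size at least 3. *)
Definition acyclic (T : finType) (e : rel T) : Prop :=
  forall c : seq T, ucycle e c -> (size c < 3)%N.

Definition is_tree (T : finType) (e : rel T) : Prop :=
  [/\ symmetric e, irreflexive e, forall x y : T, connect e x y & acyclic e].

Record rooted_tree := RootedTree {
  vertex : finType;
  adj : rel vertex;
  tree_root : vertex;
  adj_tree : is_tree adj
}.

(* Least number of edges of a walk from x to y; the search over n < #|T|
   suffices, and returns #|T| when y is not reachable from x. *)
Definition graph_dist (T : finType) (e : rel T) (x y : T) : nat :=
  find (fun n => [exists p : n.-tuple T, path e x p && (last x p == y)])
       (iota 0 #|T|).

Definition height (t : rooted_tree) : nat :=
  (\max_(x : vertex t) graph_dist (@adj t) (tree_root t) x)%N.

Definition adjacency_matrix (T : finType) (e : rel T) : 'M[algC]_#|T| :=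
  \matrix_(i, j) (e (enum_val i) (enum_val j))%:R.

Definition totally_real_integer (x : algC) : Prop :=
  x \in Aint /\ forall z : algC, root (minCpoly x) z -> z \is Num.real.

Definition eigenvalue_at_height (h : nat) (x : algC) : Prop :=
  exists2 t : rooted_tree, height t = h & eigenvalue (adjacency_matrix (@adj t)) x.

Definition arboreal_height (x : algC) (h : nat) : Prop :=
  eigenvalue_at_height h x /\
  forall k : nat, eigenvalue_at_height k x -> (h <= k)%N.

(* The set A_h, as a predicate. *)
Definition in_A (h : nat) (x : algC) : Prop :=
  totally_real_integer x /\ arboreal_height x h.

(* Main.v *)
(* Put x = (D lambda)^2.  Giving the root the value 1, one sees that D lambda
   is an eigenvalue of the height-2 tree whose root has children i with k_i
   leaves each as soon as sum_i 1 / (x - k_i) = 1.  To write 1 in this way,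
   let P be the minimal polynomial of alpha = lambda^2; its roots a_i are
   simple and positive.  Choose rationals 0 < q_1 < a_1 < q_2 < a_2 < ... and
   put A = prod_i (X - q_i).  By interlacing, the residues c_i of (A - P) / A
   at the q_i are positive, and they are rational; evaluating
   1 - P / A = sum_i c_i / (X - q_i) at alpha gives
   1 = sum_i c_i / (alpha - q_i).  It remains to take D clearing all
   denominators and to repeat the i-th child D^2 c_i times, with D^2 q_i
   leaves.  Conversely a nonempty tree of height at most 1 is a star, whose
   eigenvalues have integer squares. *)

Require Import Defs.
From mathcomp Require Import all_boot all_order all_algebra all_field.
From mathcomp Require Import ring zify.

Set Implicit Arguments.
Unset Strict Implicit.
Unset Printing Implicit Defensive.

Import Order.TTheory GRing.Theory Num.Theory.

Local Open Scope ring_scope.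

(** * Conjugates of algebraic numbers *)

Lemma root_minCpoly_min (p : {poly rat}) (x z : algC) :
  root (map_poly ratr p) x -> root (minCpoly x) z -> root (map_poly ratr p) z.
Proof.
have [q [-> _] ->] := minCpolyP x => q_dv_p.
by apply: root_dvdp; rewrite dvdp_map.
Qed.

(** Let [g] be the gcd of [p] and its derivative. By minimality [p] divides [p %/ g], so [g] is
    constant, or [p] divides [g], hence the nonzero derivative of smaller degree, which is
    absurd. *)
Lemma separable_minCpoly (x : algC) : separable_poly (minCpoly x).
Proof.
have [p [Dp mon_p] min_p] := minCpolyP x.
rewrite Dp separable_map unlock; set g := gcdp p p^`().
have p_neq0 := monic_neq0 mon_p.
have sz_p : (1 < size p)%N.
  by rewrite -(size_map_poly (ratr : {rmorphism rat -> algC})) -Dp size_minCpoly.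
have dvgp : g %| p by apply: dvdp_gcdl.
have g0 : g != 0 by rewrite gcdp_eq0 negb_and p_neq0.
have: root (map_poly ratr (p %/ g * g)) x.
  by rewrite divpK // -Dp root_minCpoly.
rewrite rmorphM rootM !min_p => /orP[] dvp.
  have pg0 : p %/ g != 0 by rewrite dvdp_div_eq0.
  have := dvdp_leq pg0 dvp; rewrite size_divp // /coprimep -/g.
  have : (0 < size g)%N by rewrite size_poly_gt0.
  move: sz_p; move: (size p) (size g) => m n; lia.
have p'0 : p^`() != 0.
  apply/eqP=> /polyP/(_ (size p).-2)/eqP; rewrite coef_deriv coef0 mulrn_eq0.
  have -> : (size p).-2.+1 = (size p).-1 by move: sz_p; case: (size p) => [|[]].
  rewrite -lead_coefE (monicP mon_p) oner_eq0 orbF.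
  by move: sz_p; case: (size p) => [|[]].
have := dvdp_leq p'0 (dvdp_trans dvp (dvdp_gcdr _ _)).
by rewrite leqNgt lt_size_deriv.
Qed.

Lemma totally_real_sqr_ge0 (x z : algC) :
  (forall y, root (minCpoly x) y -> y \is Num.real) ->
  root (minCpoly (x ^+ 2)) z -> 0 <= z.
Proof.
move=> x_real.
have [p [Dp _] _] := minCpolyP x.
pose e := even_poly p; pose o := odd_poly p.
(* r(X^2) = p(X) p(-X), so the roots of r are the squares of those of p. *)
pose r : {poly rat} := e ^+ 2 - 'X * o ^+ 2.
have r_sqr w :
    (map_poly ratr r).[w ^+ 2] = (minCpoly x).[w] * (minCpoly x).[- w].
  rewrite Dp -[p in RHS]poly_even_odd -/e -/o.
  rewrite !(rmorphB, rmorphD, rmorphM, rmorphXn) /= !map_comp_poly map_polyX map_polyXn.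
  rewrite !(hornerD, hornerN, hornerX, hornerXn, horner_exp, horner_comp, hornerM) sqrrN.
  ring.
have rx : root (map_poly ratr r) (x ^+ 2).
  by rewrite /root r_sqr (eqP (root_minCpoly x)) mul0r.
(* Either [sqrtC z] or its opposite is a conjugate of [x], so real, and [z] is its square. *)
move=> /(root_minCpoly_min rx); rewrite -[z]sqrtCK /root r_sqr mulf_eq0.
by case/orP=> /x_real; rewrite ?realN => /real_exprn_even_ge0 ->.
Qed.

(** If X divided [p], the cofactor would still vanish at [x] and have smaller degree. *)
Lemma root_minCpoly_neq0 (x z : algC) : x != 0 -> root (minCpoly x) z -> z != 0.
Proof.
move=> x0; apply: contraTneq => ->; have [p [-> mon_p] min_p] := minCpolyP x.
rewrite -[0](rmorph0 (ratr : {rmorphism rat -> algC})) fmorph_root.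
apply/negP=> /factor_theorem[q]; rewrite subr0 => Dq.
have q0 : q != 0.
  apply: contraTneq mon_p => q0.
  by rewrite Dq q0 mul0r monicE lead_coef0 eq_sym oner_eq0.
have : root (map_poly ratr p) x by rewrite min_p.
rewrite Dq rmorphM rootM /= map_polyX rootX (negPf x0) orbF min_p.
move=> /(dvdp_leq q0).
by rewrite Dq size_mulX // ltnn.
Qed.

(** * Rational points between real algebraic numbers *)

Lemma rat_dense (x y : algC) : x \is Num.real -> y \is Num.real -> x < y ->
  exists q : rat, x < ratr q < y.
Proof.
move=> xR yR xy; have yx : 0 < y - x by rewrite subr_gt0.
have := archi_boundP (_ : 0 <= (y - x)^-1); rewrite invr_ge0 (ltW yx) => /(_ isT).
set N := Num.bound _ => ltN.
have N0 : 0 < N%:R :> algC by apply: lt_trans ltN; rewrite invr_gt0.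
have NxR : N%:R * x \is Num.real by rewrite rpredM ?realn.
have /andP[fl fu] := real_floor_itv NxR.
(* As [N] exceeds 1/(y - x), the first multiple of 1/N beyond [x] lies below [y]. *)
exists ((Num.floor (N%:R * x) + 1)%:~R / N%:R).
rewrite fmorph_div rmorph_int rmorph_nat ltr_pdivlMr // mulrC fu /=.
rewrite ltr_pdivrMr // intrD (le_lt_trans (lerD fl (lexx 1%:~R))) //.
by rewrite mulrC -ltrBrDl -mulrBl -ltr_pdivrMl // mulr1.
Qed.

(** Yields interlacing without sorting the roots, by treating each root [a] separately. Going
    through [s], the point is raised past each new [b] below [a]. *)
Lemma rat_isolate (a : algC) (s : seq algC) : 0 < a -> all (mem Num.real) s ->
  exists q : rat,
    0 < (ratr q : algC) < a /\ {in s, forall b : algC, b < a -> b < ratr q}.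
Proof.
move=> a0; elim: s => [_ | b s IHs /andP[bR /IHs[q [/andP[q0 qa] qs]]]].
  by have [q q_a] := rat_dense (real0 _) (gtr0_real a0) a0; exists q.
have [ba | nba] := boolP (b < a); last first.
  exists q; rewrite q0 qa; split=> // c; rewrite inE => /predU1P[-> | /qs //].
  by rewrite (negPf nba).
have qR : ratr q \is @Num.real algC by rewrite gtr0_real.
have mR : Num.max b (ratr q) \is Num.real by rewrite max_real.
have [|r /andP[]] := rat_dense mR (gtr0_real a0).
  by rewrite comparable_gt_max ?ba ?real_comparable.
rewrite comparable_gt_max ?real_comparable // => /andP[br qr] ra.
exists r; rewrite ra (lt_trans q0 qr); split=> // c.
rewrite inE => /predU1P[-> // | cs ca].
by rewrite (lt_trans _ qr) // qs.
Qed.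

(** * Partial fractions with positive rational coefficients *)

Lemma lagrange_residues (F : fieldType) (I : finType) (a q : I -> F) (x : F) :
    injective q -> (forall i, x != q i) -> \prod_i (x - a i) = 0 ->
  \sum_i (- (\prod_j (q i - a j) / \prod_(j | j != i) (q i - q j))) / (x - q i)
    = 1.
Proof.
move=> inj_q xq xa.
(* Interpolate \prod_i (X - a i) - \prod_i (X - q i), of size at most #|I|, at
   the points q i. *)
pose A : {poly F} := \prod_i ('X - (a i)%:P).
pose Q : {poly F} := \prod_i ('X - (q i)%:P).
(* [c i] is the residue of A/Q at [q i], and L/Q the sum of the resulting simple fractions. *)
pose c i := \prod_j (q i - a j) / \prod_(j | j != i) (q i - q j).
pose L := \sum_i c i *: \prod_(j | j != i) ('X - (q j)%:P).
have sz (b : I -> F) : size (\prod_i ('X - (b i)%:P)) = #|I|.+1.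
  by rewrite size_prod_XsubC /index_enum -enumT -cardT.
have lc (b : I -> F) : (\prod_i ('X - (b i)%:P))`_#|I| = 1.
  have := monicP (monic_prod_XsubC (index_enum I) predT b).
  by rewrite lead_coefE sz.
have hor P (b : I -> F) y :
    (\prod_(i | P i) ('X - (b i)%:P)).[y] = \prod_(i | P i) (y - b i).
  by rewrite horner_prod; apply: eq_bigr => i _; rewrite hornerXsubC.
have : A - Q - L = 0.
  apply: (@roots_geq_poly_eq0 _ _ (image q I)).
  - apply/allP=> _ /imageP[k _ ->]; rewrite /root hornerD hornerN hornerD hornerN.
    have -> : Q.[q k] = 0 by rewrite hor (bigD1 k) //= subrr mul0r.
    rewrite hor horner_sum oppr0 addr0 [X in - X](bigD1 k) //=.
    rewrite [X in - (_ + X)]big1 => [|i ik]; last first.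
      by rewrite hornerZ hor (bigD1 k) 1?eq_sym //= subrr mul0r mulr0.
    rewrite hornerZ hor addr0 divfK ?subrr //.
    by apply/prodf_neq0 => j jk; rewrite subr_eq0 (inj_eq inj_q) eq_sym.
  - by rewrite map_inj_uniq ?enum_uniq.
  rewrite size_map -cardE; apply: leq_trans (size_polyD _ _) _; rewrite size_polyN.
  rewrite geq_max; apply/andP; split.
    (* Both products are monic of degree [#|I|], so their leading terms cancel. *)
    apply/leq_sizeP => j; rewrite leq_eqVlt => /predU1P[<-|lt_j].
      by rewrite coefB !lc subrr.
    by rewrite coefB !nth_default ?subrr ?sz.
  apply: leq_trans (size_sum _ _ _) _; apply/bigmax_leqP => i _.
  apply: leq_trans (size_scale_leq _ _) _.
  rewrite -big_filter size_prod_XsubC size_filter.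
  rewrite -sum1_count sum1_card cardC1 prednK ?leqnn //.
  by apply/card_gt0P; exists i.
(* As A(x) = 0, the identity gives -Q(x) = L(x); it remains to divide by Q(x). *)
move/(congr1 (horner^~ x)); rewrite !hornerE !hor xa horner_sum => /eqP.
rewrite sub0r subr_eq0 => /eqP QL.
have Q0 : \prod_i (x - q i) != 0 by apply/prodf_neq0 => i _; rewrite subr_eq0.
apply: (mulfI Q0); rewrite mulr1 -[RHS]opprK QL mulr_sumr -sumrN.
apply: eq_bigr => i _; rewrite hornerZ hor -/(c i) (bigD1 i) //=.
by field; rewrite subr_eq0.
Qed.

Lemma common_denominator (I : finType) (f : I -> algC) : (forall i, f i \in Crat) ->
  exists2 D : nat, (0 < D)%N & forall i, D%:R * f i \in Num.int.
Proof.
move=> fQ; have /fin_all_exists[r Dr] i : exists r : rat, f i = ratr r by apply/CratP.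
exists (\prod_i `|denq (r i)|)%N => [|i].
  by rewrite prodn_gt0 // => i; rewrite absz_gt0 denq_eq0.
rewrite (bigD1 i) //= mulnC natrM -mulrA rpredM ?natr_int // Dr.
rewrite -{2}[r i]divq_num_den fmorph_div !rmorph_int pmulrn absz_denq.
by rewrite mulrC divfK ?intr_eq0 ?denq_eq0 ?intr_int.
Qed.

Lemma positive_partial_fractions (x : algC) :
    x \notin Crat -> (forall z, root (minCpoly x) z -> 0 < z) ->
  exists (I : finType) (c q : I -> algC),
    [/\ forall i, c i \in Crat, forall i, q i \in Crat,
        forall i, 0 < c i, forall i, 0 < q i &
        \sum_i c i / (x - q i) = 1].
Proof.
move=> xNQ min_gt0; pose m := minCpoly x.
have [r Dm] := closed_field_poly_normal m.
rewrite (monicP (minCpoly_monic x)) scale1r in Dm.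
have r_root z : (z \in r) = root m z by rewrite Dm root_prod_XsubC.
have uniq_r : uniq r by rewrite -separable_prod_XsubC -Dm separable_minCpoly.
pose a (i : 'I_(size r)) := r`_i.
have a_r i : a i \in r by apply: mem_nth.
have a_gt0 i : 0 < a i by apply: min_gt0; rewrite -r_root.
have a_inj : injective a.
  by move=> i j /eqP; rewrite nth_uniq // => /eqP/val_inj.
have mE y : m.[y] = \prod_i (y - a i).
  rewrite Dm (big_nth 0) big_mkord horner_prod.
  by apply: eq_bigr => i _; rewrite hornerXsubC.
have r_real : all (mem Num.real) r.
  by apply/allP=> z; rewrite r_root => /min_gt0/gtr0_real.
have /fin_all_exists[s sP] i := rat_isolate (a_gt0 i) r_real.
pose q i : algC := ratr (s i).
have q_gt0 i : 0 < q i by case: (sP i) => /andP[].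
have q_lt_a i : q i < a i by case: (sP i) => /andP[].
have a_lt_q i j : a j < a i -> a j < q i by case: (sP i) => _; apply.
have sep i j : i != j -> (a i < a j) || (a j < a i).
  by move=> ij; rewrite -real_neqr_lt ?gtr0_real // (inj_eq a_inj).
have q_mono i j : a i < a j -> q i < q j.
  by move=> /a_lt_q; apply: lt_trans.
have q_inj : injective q.
  move=> i j /eqP; apply: contraTeq => /sep/orP[] /q_mono lt_q.
    by rewrite lt_eqF.
  by rewrite gt_eqF.
have qQ i : q i \in Crat by apply: Crat_rat.
pose c i := - (\prod_j (q i - a j) / \prod_(j | j != i) (q i - q j)).
exists 'I_(size r), c, q.
split=> // [i | i |].
(* The numerator of [c i] is the value of the rational polynomial [m] at a rational point. *)
- rewrite /c rpredN; apply: rpred_div; last by apply: rpred_prod => j _; apply: rpredB.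
  have [p [Dp _] _] := minCpolyP x.
  by rewrite -mE /m Dp horner_map Crat_rat.
- (* c_i = (a_i - q_i) prod_(j != i) (q_i - a_j) / (q_i - q_j), and a_j, q_j
     lie on the same side of q_i. *)
  rewrite /c (bigD1 i) //= -mulrA -prodf_div -mulNr opprB mulr_gt0 ?subr_gt0 //.
  apply: prodr_gt0 => j; rewrite eq_sym => /sep/orP[] lt_a.
    rewrite -[_ / _]mulrNN -invrN !opprB divr_gt0 // subr_gt0 ?q_mono //.
    exact: lt_trans lt_a.
  by rewrite divr_gt0 ?subr_gt0 ?q_mono ?a_lt_q.
apply: lagrange_residues => // [i|].
  by apply: contraNneq xNQ => ->.
by rewrite -mE; apply/eqP/root_minCpoly.
Qed.

Lemma totally_real_integer_natmul (D : nat) (x : algC) : (0 < D)%N ->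
  totally_real_integer x -> totally_real_integer (D%:R * x).
Proof.
move=> D0 [xA x_real]; have Dn0 : D%:R != 0 :> algC by rewrite pnatr_eq0 -lt0n.
split=> [|z]; first by rewrite rpredM ?rpred_nat.
have [p [Dp _] _] := minCpolyP x.
(* This is p(X/D), whose roots are [D] times the conjugates of [x]. *)
pose p_D : {poly rat} := p \Po (D%:R^-1 *: 'X).
have p_DE y : root (map_poly ratr p_D) y = root (minCpoly x) (D%:R^-1 * y).
  rewrite Dp map_comp_poly root_comp map_polyZ map_polyX.
  by rewrite hornerZ hornerX fmorphV rmorph_nat.
have pDx : root (map_poly ratr p_D) (D%:R * x).
  by rewrite p_DE mulKf // root_minCpoly.
move=> /(root_minCpoly_min pDx); rewrite p_DE => /x_real.
by move=> /(rpredM (realn _ D)); rewrite mulVKf.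
Qed.

(** * Cycles, distances and eigenvectors of graphs *)

Lemma acyclic_rank (T : finType) (e : rel T) (d : T -> nat) : symmetric e ->
  (forall x y z, e x y -> e x z -> d y <= d x -> d z <= d x -> y = z)%N ->
  acyclic e.
Proof.
move=> sym_e uniq_e c /andP[cyc_c uniq_c]; rewrite ltnNge; apply/negP => c3.
have [x0 x0c] : exists x0, x0 \in c.
  by case: c c3 {cyc_c uniq_c} => // x c _; exists x; rewrite mem_head.
(* Both neighbours on c of a vertex of maximal rank have rank at most its own,
   hence coincide. *)
have [x /= xc x_max] := arg_maxnP d x0c.
have next_prev_x : next c x = prev c x.
  apply: (uniq_e x); rewrite ?next_cycle 1?sym_e ?prev_cycle //.
    by apply: x_max; have: next c x \in c by rewrite mem_next.
  by apply: x_max; have: prev c x \in c by rewrite mem_prev.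
(* Two steps forward from [x] would return to [x], which is impossible on a cycle with at least 3
   vertices. *)
have := next_prev uniq_c x; rewrite -next_prev_x.
have [i c' Dc] := rot_to xc.
rewrite -!(next_rot i uniq_c) Dc /=.
move: uniq_c c3; rewrite -(rot_uniq i) -(size_rot i) Dc.
case: c' {Dc} => [|y [|z c']] //= /and3P[].
rewrite !inE !negb_or => /and3P[xy xz _] /andP[yz _] _ _.
by rewrite eqxx [y == x]eq_sym (negPf xy) eqxx => zx; rewrite zx eqxx in xz.
Qed.

Lemma graph_dist_path (T : finType) (e : rel T) (x y : T) (p : seq T) :
  path e x p -> last x p = y -> (graph_dist e x y <= size p)%N.
Proof.
move=> e_p last_p; rewrite /graph_dist leqNgt; apply/negP => lt_p.
have := before_find 0%N lt_p; rewrite nth_iota; last first.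
  by rewrite (leq_trans lt_p) // (leq_trans (find_size _ _)) ?size_iota.
by move=> /negbT /= /existsPn/(_ (in_tuple p)); rewrite e_p last_p eqxx.
Qed.

(** The bound rules out the default value [#|T|] of an unsuccessful search. *)
Lemma graph_distP (T : finType) (e : rel T) (x y : T) :
  (graph_dist e x y < #|T|)%N ->
  exists p, [/\ path e x p, last x p = y & size p = graph_dist e x y].
Proof.
rewrite -{1}(size_iota 0 #|T|) -has_find => has_p.
have := nth_find 0%N has_p; rewrite nth_iota -?has_find; last first.
  by rewrite -[X in (_ < X)%N](size_iota 0) -has_find.
by case/existsP=> p /andP[e_p /eqP last_p]; exists p; rewrite size_tuple.
Qed.

Lemma eigenvalue_adjacencyP (T : finType) (e : rel T) (a : algC) :
  eigenvalue (adjacency_matrix e) a <->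
  exists2 f : T -> algC, (forall y, \sum_(x | e x y) f x = a * f y) &
    exists x, f x != 0.
Proof.
have mulE (v : 'rV[algC]_#|T|) y :
    (v *m adjacency_matrix e) 0 (enum_rank y) =
    \sum_(x | e x y) v 0 (enum_rank x).
  rewrite mxE [RHS]big_mkcond [RHS](reindex (@enum_val T T)) /=; last first.
    exact: (onW_bij _ (@enum_val_bij T)).
  by apply: eq_bigr => i _; rewrite !mxE enum_rankK enum_valK mulr_natr mulrb.
split=> [/eigenvalueP[v vA v0] | [f fA [x fx]]].
  exists (fun x => v 0 (enum_rank x)) => [y|]; first by rewrite -mulE vA mxE.
  have /rV0Pn[i vi] := v0; by exists (enum_val i); rewrite enum_valK.
apply/eigenvalueP; exists (\row_i f (enum_val i)).
  apply/rowP=> j; rewrite -[j]enum_valK mulE !mxE enum_rankK -fA.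
  by apply: eq_bigr => y _; rewrite mxE enum_rankK.
by apply/rV0Pn; exists (enum_rank x); rewrite mxE enum_rankK.
Qed.

(** * Trees of height at most one *)

Lemma height_le1_eigenvalue (t : rooted_tree) (a : algC) : (height t <= 1)%N ->
  eigenvalue (adjacency_matrix (@adj t)) a -> a ^+ 2 \in Num.int.
Proof.
case: t => T e r [sym_e irr_e con_e acyc_e]; rewrite /height /= => ht.
have root_adj x : x != r -> e r x.
  (* A lone vertex is the root; otherwise a distance at most 1 is not the default [#|T|], so it
     comes from a path. *)
  move=> xr; have [T1|T1] := leqP #|T| 1.
    by have /card_le1P/(_ x isT)/(_ r) := T1; rewrite !inE eq_sym (negPf xr).
  have dx : (graph_dist e r x <= 1)%N by apply: leq_trans ht; apply: leq_bigmax.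
  have [[|y [|z p]]] := graph_distP (leq_ltn_trans dx T1).
  - by case=> _ /= rx; rewrite rx eqxx in xr.
  - by case=> /andP[ry _] /= <-.
  by case=> _ _ /= Dp; rewrite -Dp in dx.
have not_adj x y : x != r -> y != r -> e x y = false.
  move=> xr yr; apply/negP=> xy.
  (* An edge between two non-root vertices would close a triangle with the root. *)
  have /acyc_e : ucycle e [:: r; x; y].
    rewrite /ucycle /= !root_adj // xy sym_e root_adj //= !inE negb_or.
    rewrite ![r == _]eq_sym xr yr /= andbT.
    by apply: contraTneq xy => ->; rewrite irr_e.
  by [].
move=> /eigenvalue_adjacencyP[f fA [x fx]].
have leaf y : y != r -> a * f y = f r.
  move=> yr; rewrite -fA (bigD1 r) ?root_adj //= big1 ?addr0 // => z /andP[zy zr].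
  by rewrite not_adj in zy.
(* If [f] vanishes at the root, it is nonzero at some leaf, where the equation forces [a] = 0. *)
have [fr0 | fr0] := eqVneq (f r) 0.
  have xr : x != r by apply: contraNneq fx => ->; rewrite fr0.
  have /eqP := leaf x xr; rewrite fr0 mulf_eq0 (negPf fx) orbF => /eqP->.
  by rewrite expr0n.
(* Here a^2 f(r) is the sum of a f(y) = f(r) over the neighbours y of the root. *)
have -> : a ^+ 2 = (#|[pred y | e y r]|)%:R; last exact: natr_int.
apply: (mulIf fr0); rewrite expr2 -mulrA -fA mulr_sumr mulr_natl -sumr_const.
apply: eq_bigr => y yr; rewrite leaf //.
by apply: contraTneq yr => ->; rewrite irr_e.
Qed.

(** * Trees of height two *)

(* None is the root, Some (existT _ i None) its child i, and
   Some (existT _ i (Some l)) the l-th leaf below that child. *)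
Definition broom_vertex (I : finType) (k : I -> nat) : finType :=
  option {i : I & option 'I_(k i)}.

Definition broom_adj (I : finType) (k : I -> nat) : rel (broom_vertex k) :=
  fun v w => match v, w with
  | None, Some (existT _ None) => true
  | Some (existT _ None), None => true
  | Some (existT i None), Some (existT j (Some _)) => i == j
  | Some (existT i (Some _)), Some (existT j None) => i == j
  | _, _ => false
  end.

Definition broom_depth (I : finType) (k : I -> nat)
    (v : broom_vertex k) : nat :=
  match v with
  | None => 0
  | Some (existT _ None) => 1
  | Some (existT _ (Some _)) => 2
  end.

Lemma broom_adj_sym (I : finType) (k : I -> nat) : symmetric (@broom_adj I k).
Proof. by move=> [[i [l|]]|] [[j [m|]]|] //=; rewrite eq_sym. Qed.

Lemma broom_path (I : finType) (k : I -> nat) (v : broom_vertex k) :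
  exists p, [/\ path (@broom_adj I k) None p, last None p = v &
                size p = broom_depth v].
Proof.
case: v => [[i [l|]]|]; last by exists [::].
  exists [:: Some (existT _ i None); Some (existT _ i (Some l))].
  by rewrite /= eqxx.
by exists [:: Some (existT _ i None)].
Qed.

Lemma broom_is_tree (I : finType) (k : I -> nat) : is_tree (@broom_adj I k).
Proof.
have sym_k := @broom_adj_sym I k; split=> //.
- by move=> [[i [l|]]|] /=.
- have root_connect v : connect (@broom_adj I k) None v.
    by have [p [e_p <- _]] := broom_path v; apply/connectP; exists p.
  move=> v w; apply: connect_trans (root_connect w).
  by rewrite (sym_connect_sym sym_k).
(* Only the parent of a vertex is a neighbour of no larger depth. *)
apply: (acyclic_rank (d := @broom_depth I k)) => //.
move=> [[i [l|]]|] [[j [m|]]|] //= [[j' [m'|]]|] //=.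
by move=> /eqP <- /eqP <-.
Qed.

Definition broom (I : finType) (k : I -> nat) : rooted_tree :=
  RootedTree None (broom_is_tree k).

Lemma broom_height (I : finType) (k : I -> nat) (i0 : I) : (0 < k i0)%N ->
  height (broom k) = 2%N.
Proof.
move=> k_gt0; apply/eqP; rewrite eqn_leq /height /=; apply/andP; split.
  apply/bigmax_leqP => v _; have [p [e_p last_p sz_p]] := broom_path v.
  apply: leq_trans (graph_dist_path e_p last_p) _; rewrite sz_p.
  by case: v {last_p sz_p} => [[i [l|]]|].
pose v : broom_vertex k := Some (existT _ i0 (Some (Ordinal k_gt0))).
apply: leq_trans (leq_bigmax v); rewrite leqNgt; apply/negP=> dist_lt2.
(* With two vertices, a distance below 2 comes from a path, not from the default value. *)
have card_gt1 : (1 < #|broom_vertex k|)%N by apply/card_gt1P; exists None, v.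
have := graph_distP (leq_trans dist_lt2 card_gt1) => -[p [e_p last_p sz_p]].
case: p e_p last_p sz_p dist_lt2 => [|w [|w' p]] //=; last by move=> _ _ <-.
by move=> e_w Dw; rewrite Dw /= in e_w.
Qed.

Lemma big_option (R : Type) (idx : R) (op : Monoid.com_law idx) (T : finType)
    (F : option T -> R) :
  \big[op/idx]_v F v = op (F None) (\big[op/idx]_t F (Some t)).
Proof.
rewrite (bigD1 None) //=; congr (op _ _).
by rewrite (reindex_omap Some id) => [|[]] //=; apply: eq_bigl => t; rewrite eqxx.
Qed.

Lemma sum_broom (I : finType) (k : I -> nat) (F : broom_vertex k -> algC) :
  \sum_v F v = F None + \sum_i (F (Some (existT _ i None)) +
    \sum_(l < k i) F (Some (existT _ i (Some l)))).
Proof.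
rewrite big_option; congr (_ + _).
under [RHS]eq_bigr => i _ do
  rewrite -(big_option _ (fun o => F (Some (existT (fun i => option 'I_(k i)) i o)))).
rewrite sig_big_dep; apply: eq_big => [|[i o] _] //.
Qed.

Lemma broom_eigenvalue (I : finType) (k : I -> nat) (a : algC) :
    (forall i, a ^+ 2 != (k i)%:R) -> \sum_i (a ^+ 2 - (k i)%:R)^-1 = 1 ->
  eigenvalue (adjacency_matrix (@broom_adj I k)) a.
Proof.
move=> ak sum1; apply/eigenvalue_adjacencyP.
(* The equation at a child, 1 + k_i g_i = a^2 g_i, determines [g]; at a leaf it is immediate, and at
   the root it follows from the g_i summing to 1. *)
pose g i := (a ^+ 2 - (k i)%:R)^-1.
exists (fun v : broom_vertex k => match v with
  | None => 1
  | Some (existT i None) => a * g i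
  | Some (existT i (Some _)) => g i
  end); last by exists None; rewrite oner_eq0.
move=> v; rewrite big_mkcond sum_broom.
case: v => [[i [l|]]|] /=.
- rewrite add0r (bigD1 i) //= eqxx big1_eq addr0 big1 ?addr0 // => j ji.
  by rewrite (negPf ji) big1_eq addr0.
- rewrite (bigD1 i) //= [X in _ + (_ + X)]big1 => [|j ji]; last first.
    by rewrite (negPf ji) big1_eq addr0.
  rewrite eqxx sumr_const card_ord -mulr_natr /g; field.
  by rewrite subr_eq0.
rewrite add0r mulr1 -[RHS]mulr1 -sum1 mulr_sumr.
by apply: eq_bigr => i _; rewrite big1_eq addr0.
Qed.

Lemma eigenvalue_at_height2 (I : finType) (k : I -> nat) (a : algC) :
    (forall i, 0 < k i)%N -> (forall i, a ^+ 2 != (k i)%:R) ->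
    \sum_i (a ^+ 2 - (k i)%:R)^-1 = 1 ->
  eigenvalue_at_height 2 a.
Proof.
move=> k_gt0 ak sum1; exists (broom k); last exact: broom_eigenvalue.
have /card_gt0P[i0 _] : (0 < #|I|)%N.
  rewrite lt0n; apply/eqP => /card0_eq I0.
  by move: sum1; rewrite big_pred0 // => /esym/eqP; rewrite oner_eq0.
exact: broom_height (k_gt0 i0).
Qed.

(** * Clearing denominators *)

Theorem theorem4 (lambda : algC)
    (lambda_real : totally_real_integer lambda)
    (lambda2_notin_Z : lambda ^+ 2 \isn't a Num.int) :
  exists2 D : nat, (0 < D)%N & in_A 2 (D%:R * lambda).
Proof.
pose x := lambda ^+ 2; have xA : x \in Aint by rewrite rpredX ?lambda_real.1.
have xNQ : x \notin Crat by apply: contra lambda2_notin_Z => /Cint_rat_Aint->.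
have x0 : x != 0 by apply: contraNneq xNQ => ->; exact: rpred0.
have [z z_root|I [c [q [cQ qQ c_gt0 q_gt0 sum1]]]] :=
  positive_partial_fractions xNQ.
  by rewrite lt0r (root_minCpoly_neq0 x0) ?(totally_real_sqr_ge0 lambda_real.2).
have [D1 D1_gt0 D1c] := common_denominator cQ.
have [D2 D2_gt0 D2q] := common_denominator qQ.
pose D := (D1 * D2)%N; have D_gt0 : (0 < D)%N by rewrite muln_gt0 D1_gt0.
have Dn0 : D%:R != 0 :> algC by rewrite pnatr_eq0 -lt0n.
(* The square appears because [x] scales by D^2; one factor [D] already makes [y] integral. *)
have scaled_nat (y : algC) : 0 < y -> D%:R * y \in Num.int ->
    exists n, D%:R ^+ 2 * y = n%:R.
  move=> y_gt0 Dy; apply/natrP.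
  rewrite natrEint mulr_ge0 ?exprn_ge0 ?ler0n 1?ltW // andbT.
  by rewrite expr2 -mulrA rpredM ?natr_int.
have /fin_all_exists[n Dc] i : exists n, D%:R ^+ 2 * c i = n%:R.
  by apply: scaled_nat; rewrite // /D mulnC natrM -mulrA rpredM ?natr_int ?D1c.
have /fin_all_exists[k Dq] i : exists n, D%:R ^+ 2 * q i = n%:R.
  by apply: scaled_nat; rewrite // /D natrM -mulrA rpredM ?natr_int ?D2q.
(* Irrationality keeps (D lambda)^2 away from the integers k_i and, at the end, excludes height at
   most 1. *)
have Dx_notin_Q : (D%:R * lambda) ^+ 2 \notin Crat.
  apply: contra xNQ => /(rpredM (rpredX 2 (rpredVr (rpred_nat _ D)))).
  by rewrite -exprMn mulKf.
exists D => //; split; first exact: totally_real_integer_natmul.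
split.
  (* The index pairs repeat child i exactly n_i = D^2 c_i times, turning the coefficient c_i into a
     multiplicity. *)
  apply: (eigenvalue_at_height2 (I := {i : I & 'I_(n i)})
    (k := fun u => k (tag u))).
  - move=> u; rewrite lt0n -(eqr_nat algC) -Dq mulf_neq0 ?expf_neq0 //.
    by rewrite gt_eqF.
  - by move=> u; apply: contraNneq Dx_notin_Q => ->; rewrite rpred_nat.
  rewrite -(sig_big_dep xpredT (fun=> xpredT)
    (fun i _ => ((D%:R * lambda) ^+ 2 - (k i)%:R)^-1)) /= -[RHS]sum1.
  apply: eq_bigr => i _; rewrite sumr_const card_ord -[LHS]mulr_natl.
  rewrite -Dc -Dq exprMn -/x -mulrBr.
  by rewrite invfM mulrACA divff ?mul1r // expf_neq0.
move=> h [t <- t_eig]; rewrite ltnNge; apply: contra Dx_notin_Q => ht.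
by have /intrP[m ->] := height_le1_eigenvalue ht t_eig; rewrite rpred_int.
Qed.
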